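(* Assume that there is a constant $\kappa$ such that, for every patch of size $m\times m'$ and every orientation $\theta$, the selection step of the fast approximation algorithm is repeated at most $\kappa\max(m,m')$ times. Then the fast approximation algorithm used to obtain the PSML (Parallel Stroked Multi Line) approximation of a whole $n\times n$ image, i.e. running the fast patch approximation algorithm on every patch of the quadtree decomposition of the image, has time complexity $O(n^3)$.
   Context: Cost model: time is the number of elementary operations on a unit-cost machine with real arithmetic (arithmetic, comparison, memory access). PSML model. A patch of size $m\times m'$ is a rectangular array of $m\times m'$ pixels with real gray levels; index its pixels by $\{0,\dots,m-1\}\times\{0,\dots,m'-1\}$. The orientation is quantized: fix $C=(\lfloor m/2\rfloor,\lceil m'/2\rceil)$ and let $O$ range over $D_O=\{(0,y): y=0,\dots,m'-1\}\cup\{(x,m'-1): x=0,\dots,m-1\}$; $\theta\in[0,\pi)$ is the angle between the line through $C$ and $O$ and the horizontal axis (arbitrary, say $0$, if $O=C$). Thus there are $m+m'-1$ choices of $O$. For each orientation $\theta$, the patch is partitioned into $p=p_\theta$ nonempty parallel digital lines $u_1,\dots,u_p$ of unit width and slope $\theta$, by a fixed rasterization rule for which the index of the line containing a given pixel is computable in $O(1)$ time; $p\le\sqrt{m^2+m'^2}$. A PSML image is given by $\theta$, a binary stream $G=g_1\cdots g_p\in\{0,1\}^p$ and gray levels $c_1,c_2$: every pixel of $u_i$ has value $c_1$ if $g_i=0$ and $c_2$ if $g_i=1$. Let $S_i$ be the sum of the gray levels of the pixels of $u_i$ in the given patch and $N_i$ the number of pixels of $u_i$. For $c\in\{0,1\}$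 put $SC_{c,G}=\sum_{i:g_i=c}S_i$ and $NC_{c,G}=\sum_{i:g_i=c}N_i$. For given $\theta,G$ one takes $c_1=SC_{0,G}/NC_{0,G}$ and $c_2=SC_{1,G}/NC_{1,G}$ (arbitrary, say $0$, if the denominator is $0$), and $err_G$ denotes the resulting mean squared error of the PSML image with respect to the patch. Fast patch approximation algorithm. The neighbors of $G=g_1\cdots g_p$ are the streams $G_k$, $k=1,\dots,p$, obtained from $G$ by flipping the bit $g_k$; $N(G)$ is the set of neighbors. For each orientation $\theta$ (each choice of $O$), do the following. (1) Compute all $S_i,N_i$ and the initial state $G^0$: with $c_m$ the mean gray level of all pixels of the patch, set $g_i=1$ if the mean gray level of the pixels of $u_i$ is lower than $c_m$, and $g_i=0$ otherwise. Compute $SC_{c,G^0}$ and $NC_{c,G^0}$ for $c=0,1$. Set the current state $G^c=G^0$. (2) Selection step: among all neighbors in $N(G^c)$ find one, $G'$, with lowest error. The parameters $c_1,c_2$ of each neighbor $G_k$ of the current state $G$ are obtained from $SC_{c,G},NC_{c,G}$ by subtracting $S_k$ and $N_k$ from the sums for the old value of bit $k$ and adding them to the sums for the new value (likewise the errors are updated from stored aggregate quantities). If $err_{G'}<err_{G^c}$, set $G^c=G'$, update the stored sums, and repeat the selection step; otherwise stop for this $\theta$ with output stream $G^c$. The output for the patch is the $(\theta,G,c_1,c_2)$ with lowest error over all orientations. Quadtree decomposition. Regard the $n\times n$ image as a grid of pixels on $[0,1]\times[0,1]$, the pixel with integer indices $(a,b)$, $0\le a,b<n$, being placed at $(a/n,b/n)$.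 For integers $i$ with $0\le i\le\log_2 n$ and $0\le j_1,j_2<2^i$, the patch of the dyadic square $S(j_1,j_2,i)=[j_1/2^i,(j_1+1)/2^i]\times[j_2/2^i,(j_2+1)/2^i]$ consists of the pixels placed in it (with right and upper sides excluded, so that the patches of each level $i$ partition the image). When $n=2^J$, level $i$ consists of $4^i$ patches of size $2^{J-i}\times 2^{J-i}$. *)

(* Defs.v *)
From HB Require Import structures.
From mathcomp Require Import all_boot all_order all_algebra.
From mathcomp Require Import reals trigo.

Set Implicit Arguments.
Unset Strict Implicit.
Unset Printing Implicit Defensive.

Import Order.TTheory GRing.Theory Num.Theory.
Local Open Scope ring_scope.

(** Unit-cost machine with real arithmetic.
    [c : comp A] is a computation; [c a t] says that it can terminate with
    result [a] after [t] elementary operations.  A computation that diverges, or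
    gets stuck on an access out of bounds or a division by zero, has no outcome.
    Binding a result to a name and branching on a computed boolean are free:
    every arithmetic operation, comparison and memory access is charged. *)

Definition comp (A : Type) : Type := A -> nat -> Prop.

Definition op (A : Type) (cost : nat) (a : A) : comp A :=
  fun b t => b = a /\ t = cost.

Definition ret (A : Type) (a : A) : comp A := op 0 a.

Definition bind (A B : Type) (c : comp A) (f : A -> comp B) : comp B :=
  fun b t => exists a t1 t2, [/\ c a t1, f a b t2 & t = (t1 + t2)%N].

Declare Scope comp_scope.
Delimit Scope comp_scope with comp.
Notation "x <- c ;; d" := (bind c (fun x => d))
  (at level 61, c at next level, right associativity) : comp_scope.
Notation "' p <- c ;; d" := (bind c (fun x => match x with p => d end))
  (at level 61, p pattern, c at next level, right associativity) : comp_scope.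
Local Open Scope comp_scope.

Definition iadd (a b : nat) : comp nat := op 1 (a + b)%N.
Definition isub (a b : nat) : comp nat := op 1 (a - b)%N.
Definition imul (a b : nat) : comp nat := op 1 (a * b)%N.
Definition idiv (a b : nat) : comp nat :=
  fun c t => [/\ (0 < b)%N, c = (a %/ b)%N & t = 1%N].
Definition ilt (a b : nat) : comp bool := op 1 (a < b)%N.
Definition ile (a b : nat) : comp bool := op 1 (a <= b)%N.
Definition bnot (b : bool) : comp bool := op 1 (~~ b).

Definition radd (R : realType) (a b : R) : comp R := op 1 (a + b).
Definition rsub (R : realType) (a b : R) : comp R := op 1 (a - b).
Definition rmul (R : realType) (a b : R) : comp R := op 1 (a * b).
Definition rdiv (R : realType) (a b : R) : comp R :=
  fun c t => [/\ b != 0, c = a / b & t = 1%N].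
Definition rlt (R : realType) (a b : R) : comp bool := op 1 (a < b).
Definition req (R : realType) (a b : R) : comp bool := op 1 (a == b).
Definition real_of_int {R : realType} (a : nat) : comp R := op 1 a%:R.

(** Arrays.  A program that writes to an array never uses the old version again,
    so [awrite] is an update in place; allocation is charged for initializing
    every cell. *)
Definition anew (T : Type) (k : nat) (v : T) : comp (seq T) := op k (nseq k v).
Definition aread (T : Type) (a : seq T) (i : nat) : comp T :=
  fun v t => onth a i = Some v /\ t = 1%N.
Definition awrite (T : Type) (a : seq T) (i : nat) (v : T) : comp (seq T) :=
  fun b t => [/\ (i < size a)%N, b = set_nth v a i v & t = 1%N].
Definition mread (T : Type) (m m' : nat) (A : 'M[T]_(m, m')) (x y : nat) :
    comp T :=
  fun v t => exists (i : 'I_m) (j : 'I_m'),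
    [/\ i = x :> nat, j = y :> nat, v = A i j & t = 1%N].

(** Each round is charged a comparison and an increment, the exit a comparison. *)
Fixpoint for_count (S : Type) (lo k : nat) (body : nat -> S -> comp S) (s : S) :
    comp S :=
  match k with
  | 0%N => op 1 s
  | k'.+1 => _ <- op 2 tt ;; s' <- body lo s ;; for_count lo.+1 k' body s'
  end.
Definition for_ (S : Type) (lo hi : nat) (body : nat -> S -> comp S) (s : S) :
    comp S :=
  for_count lo (hi - lo) body s.

Inductive loop (S : Type) (body : S -> comp (S * bool)) : S -> comp S :=
| loop_stop s s' t : body s (s', false) t -> loop body s s' t
| loop_next s s1 s2 t1 t2 : body s (s1, true) t1 -> loop body s1 s2 t2 ->
    loop body s s2 (t1 + t2)%N.

Definition runs_within (R : realType) (A : Type) (c : comp A) (T : R) : Prop :=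
  (exists a t, c a t) /\ (forall a t, c a t -> t%:R <= T).

Definition D_O (m m' : nat) : pred (nat * nat) :=
  fun O => ((O.1 == 0%N) && (O.2 < m')%N) || ((O.1 < m)%N && (O.2 == m'.-1)).

(** Angle in [0, pi) between the line through C and O and the axis of the first
    coordinate; it is 0 when O = C. *)
Definition theta (R : realType) (m m' : nat) (O : nat * nat) : R :=
  let dx := O.1%:R - (m./2)%:R in
  let dy := O.2%:R - (uphalf m')%:R in
  if dy == 0 then 0
  else acos (Num.sg dy * dx / Num.sqrt (dx ^+ 2 + dy ^+ 2)).

(** Signed distance from the pixel (x, y) to the line of slope [th] through the
    origin. *)
Definition offset (R : realType) (th : R) (x y : nat) : R :=
  y%:R * cos th - x%:R * sin th.

(** A rasterization rule; the lines are numbered from 0.  The i-th line consists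
    of the pixels in a strip of slope theta and (Euclidean) width 1, the rule
    deciding which pixels of the boundary of the strip belong to it. *)
Record raster (R : realType) := Raster {
  nlines : nat -> nat -> nat * nat -> nat;
  line : nat -> nat -> nat * nat -> nat -> nat -> nat;
  line_cost : nat -> nat -> nat * nat -> nat -> nat -> nat;
  line_lt : forall m m' O x y, D_O m m' O -> (x < m)%N -> (y < m')%N ->
    (line m m' O x y < nlines m m' O)%N;
  line_onto : forall m m' O i, (0 < m)%N -> (0 < m')%N -> D_O m m' O ->
    (i < nlines m m' O)%N ->
    exists x y, [/\ (x < m)%N, (y < m')%N & line m m' O x y = i];
  line_strip : forall m m' O, (0 < m)%N -> (0 < m')%N -> D_O m m' O ->
    exists mu : nat -> R, forall i x y,
      (i < nlines m m' O)%N -> (x < m)%N -> (y < m')%N ->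
      let d := offset (theta R m m' O) x y in
      (mu i < d < mu i + 1 -> line m m' O x y = i) /\
      (line m m' O x y = i -> mu i <= d <= mu i + 1);
  nlines_le : forall m m' O, (0 < m)%N -> (0 < m')%N -> D_O m m' O ->
    (nlines m m' O)%:R <= Num.sqrt (m%:R ^+ 2 + m'%:R ^+ 2) :> R;
  line_cost_O1 : exists K : nat, forall m m' O x y,
    D_O m m' O -> (x < m)%N -> (y < m')%N -> (line_cost m m' O x y <= K)%N
}.

Definition line_index (R : realType) (rho : raster R) (m m' : nat)
    (O : nat * nat) (x y : nat) : comp nat :=
  op (line_cost rho m m' O x y) (line rho m m' O x y).

Definition stream (R : realType) (rho : raster R) (m m' : nat)
    (O : nat * nat) : Type :=
  (nlines rho m m' O).-tuple bool.

Definition S_ (R : realType) (rho : raster R) (m m' : nat) (w : 'M[R]_(m, m'))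
    (O : nat * nat) (i : nat) : R :=
  \sum_(x < m) \sum_(y < m' | line rho m m' O x y == i) w x y.

Definition N_ (R : realType) (rho : raster R) (m m' : nat)
    (O : nat * nat) (i : nat) : nat :=
  (\sum_(x < m) \sum_(y < m' | line rho m m' O x y == i) 1)%N.

Definition SC (R : realType) (rho : raster R) (m m' : nat) (w : 'M[R]_(m, m'))
    (O : nat * nat) (c : bool) (G : stream rho m m' O) : R :=
  \sum_(i < nlines rho m m' O | tnth G i == c) S_ rho w O i.

Definition NC (R : realType) (rho : raster R) (m m' : nat)
    (O : nat * nat) (c : bool) (G : stream rho m m' O) : nat :=
  (\sum_(i < nlines rho m m' O | tnth G i == c) N_ rho m m' O i)%N.

Definition gray (R : realType) (rho : raster R) (m m' : nat) (w : 'M[R]_(m, m'))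
    (O : nat * nat) (c : bool) (G : stream rho m m' O) : R :=
  if NC c G == 0%N then 0 else SC w c G / (NC c G)%:R.

Definition psml (R : realType) (rho : raster R) (m m' : nat) (w : 'M[R]_(m, m'))
    (O : nat * nat) (G : stream rho m m' O) : 'M[R]_(m, m') :=
  \matrix_(x, y) gray w (nth false G (line rho m m' O x y)) G.

Definition err (R : realType) (rho : raster R) (m m' : nat) (w : 'M[R]_(m, m'))
    (O : nat * nat) (G : stream rho m m' O) : R :=
  (\sum_(x < m) \sum_(y < m') (w x y - psml w G x y) ^+ 2) / (m * m')%:R.

Definition flip (p : nat) (G : p.-tuple bool) (k : 'I_p) : p.-tuple bool :=
  [tuple (if i == k then ~~ tnth G i else tnth G i) | i < p].

Definition G0 (R : realType) (rho : raster R) (m m' : nat) (w : 'M[R]_(m, m'))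
    (O : nat * nat) : stream rho m m' O :=
  [tuple S_ rho w O i / (N_ rho m m' O i)%:R
         < (\sum_(x < m) \sum_(y < m') w x y) / (m * m')%:R
   | i < nlines rho m m' O].

(** The neighbor found by the selection step; ties go to the lowest index. *)
Definition selected (R : realType) (rho : raster R) (m m' : nat)
    (w : 'M[R]_(m, m')) (O : nat * nat) (G : stream rho m m' O)
    (k : 'I_(nlines rho m m' O)) : Prop :=
  (forall j, err w (flip G k : stream rho m m' O)
             <= err w (flip G j : stream rho m m' O)) /\
  (forall j : 'I_(nlines rho m m' O), (j < k)%N ->
     err w (flip G k : stream rho m m' O) < err w (flip G j : stream rho m m' O)).

(** [selections w G r]: from the current state [G] the selection step is
    executed exactly [r] times, the last, unsuccessful, one included. *)
Inductive selections (R : realType) (rho : raster R) (m m' : nat)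
    (w : 'M[R]_(m, m')) (O : nat * nat) : stream rho m m' O -> nat -> Prop :=
| selections_stop G k :
    selected w G k -> ~~ (err w (flip G k : stream rho m m' O) < err w G) ->
    selections w G 1
| selections_next G k r :
    selected w G k -> err w (flip G k : stream rho m m' O) < err w G ->
    selections w (flip G k : stream rho m m' O) r -> selections w G r.+1.

(** In the programs below, the patch consists of the pixels
    (lo1 + x, lo2 + y), x < m, y < m', of the image. *)

Record stats (R : realType) :=
  Stats { sc0 : R; nc0 : R; sc1 : R; nc1 : R }.

(** Result: arrays of the S_i and of the N_i, number p of lines, sum and sum of
    squares of the gray levels of the patch.  As p <= m + m', arrays of that size
    can be allocated before p is known. *)
Definition line_sums (R : realType) (rho : raster R) (n : nat) (img : 'M[R]_n)
    (lo1 lo2 m m' : nat) (O : nat * nat) :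
    comp (seq R * seq R * nat * R * R) :=
  l <- iadd m m' ;;
  Sa <- anew l 0 ;;
  Na <- anew l 0 ;;
  for_ 0 m (fun x => for_ 0 m' (fun y '(Sa, Na, p, tot, sq) =>
    i <- line_index rho m m' O x y ;;
    a <- iadd lo1 x ;;
    b <- iadd lo2 y ;;
    v <- mread img a b ;;
    s <- aread Sa i ;;
    s' <- radd s v ;;
    Sa' <- awrite Sa i s' ;;
    c <- aread Na i ;;
    c' <- radd c 1 ;;
    Na' <- awrite Na i c' ;;
    tot' <- radd tot v ;;
    v2 <- rmul v v ;;
    sq' <- radd sq v2 ;;
    i1 <- iadd i 1 ;;
    larger <- ilt p i1 ;;
    ret (Sa', Na', if larger then i1 else p, tot', sq')))
  (Sa, Na, 0%N, 0, 0).

Definition initial_state (R : realType) (Sa Na : seq R) (p : nat) (cm : R) :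
    comp (seq bool * stats R) :=
  G <- anew p false ;;
  for_ 0 p (fun i '(G, st) =>
    s <- aread Sa i ;;
    c <- aread Na i ;;
    mean <- rdiv s c ;;
    g <- rlt mean cm ;;
    G' <- awrite G i g ;;
    if g then
      a <- radd (sc1 st) s ;; b <- radd (nc1 st) c ;;
      ret (G', Stats (sc0 st) (nc0 st) a b)
    else
      a <- radd (sc0 st) s ;; b <- radd (nc0 st) c ;;
      ret (G', Stats a b (sc1 st) (nc1 st)))
  (G, Stats 0 0 0 0).

Definition gray_level (R : realType) (sc nc : R) : comp R :=
  z <- req nc 0 ;; if z then ret 0 else rdiv sc nc.

(** With q the sum of the squares of the gray levels and a the number of pixels,
    the mean squared error is (q - c1 * SC_0 - c2 * SC_1) / a, because
    c1 * NC_0 = SC_0 and c2 * NC_1 = SC_1. *)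
Definition error (R : realType) (q a : R) (st : stats R) : comp R :=
  c1 <- gray_level (sc0 st) (nc0 st) ;;
  c2 <- gray_level (sc1 st) (nc1 st) ;;
  x <- rmul c1 (sc0 st) ;;
  y <- rmul c2 (sc1 st) ;;
  d <- rsub q x ;;
  d' <- rsub d y ;;
  rdiv d' a.

Definition flip_stats (R : realType) (Sa Na : seq R) (G : seq bool) (st : stats R)
    (k : nat) : comp (stats R) :=
  g <- aread G k ;;
  s <- aread Sa k ;;
  c <- aread Na k ;;
  if g then
    a0 <- radd (sc0 st) s ;; b0 <- radd (nc0 st) c ;;
    a1 <- rsub (sc1 st) s ;; b1 <- rsub (nc1 st) c ;;
    ret (Stats a0 b0 a1 b1)
  else
    a0 <- rsub (sc0 st) s ;; b0 <- rsub (nc0 st) c ;;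
    a1 <- radd (sc1 st) s ;; b1 <- radd (nc1 st) c ;;
    ret (Stats a0 b0 a1 b1).

Definition selection_step (R : realType) (Sa Na : seq R) (p : nat) (q a : R)
    (cur : seq bool * stats R * R) : comp ((seq bool * stats R * R) * bool) :=
  let '(G, st, e) := cur in
  st0 <- flip_stats Sa Na G st 0 ;;
  e0 <- error q a st0 ;;
  '(k, e') <- for_ 1 p (fun j best =>
      stj <- flip_stats Sa Na G st j ;;
      ej <- error q a stj ;;
      lower <- rlt ej best.2 ;;
      ret (if lower then (j, ej) else best)) (0%N, e0) ;;
  improves <- rlt e' e ;;
  if improves then
    st' <- flip_stats Sa Na G st k ;;
    g <- aread G k ;;
    g' <- bnot g ;;
    G' <- awrite G k g' ;;
    ret ((G', st', e'), true)
  else ret (cur, false).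

(** An approximation of a patch; the orientation theta is given by O. *)
Record approx (R : realType) := Approx {
  orientation : nat * nat;
  bits : seq bool;
  level1 : R;
  level2 : R;
  mse : R
}.

Definition fast_orientation (R : realType) (rho : raster R) (n : nat)
    (img : 'M[R]_n) (lo1 lo2 m m' : nat) (O : nat * nat) : comp (approx R) :=
  '(Sa, Na, p, tot, q) <- line_sums rho img lo1 lo2 m m' O ;;
  area <- imul m m' ;;
  a <- real_of_int area ;;
  cm <- rdiv tot a ;;
  '(G, st) <- initial_state Sa Na p cm ;;
  e <- error q a st ;;
  '(G', st', e') <- loop (selection_step Sa Na p q a) (G, st, e) ;;
  c1 <- gray_level (sc0 st') (nc0 st') ;;
  c2 <- gray_level (sc1 st') (nc1 st') ;;
  ret (Approx O G' c1 c2 e').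

(** The k-th point of [D_O m m'], k < m + m' - 1. *)
Definition nth_orientation (m' k : nat) : comp (nat * nat) :=
  first <- ilt k m' ;;
  if first then ret (0%N, k)
  else y <- isub m' 1 ;; x <- isub k y ;; ret (x, y).

Definition fast_patch (R : realType) (rho : raster R) (n : nat)
    (img : 'M[R]_n) (lo1 lo2 m m' : nat) : comp (approx R) :=
  O0 <- nth_orientation m' 0 ;;
  r0 <- fast_orientation rho img lo1 lo2 m m' O0 ;;
  l <- iadd m m' ;;
  no <- isub l 1 ;;
  for_ 1 no (fun k best =>
    O <- nth_orientation m' k ;;
    r <- fast_orientation rho img lo1 lo2 m m' O ;;
    lower <- rlt (mse r) (mse best) ;;
    ret (if lower then r else best)) r0.

(** The indices a with j / s <= a / n < (j + 1) / s are those such that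
    ceil(j * n / s) <= a < ceil((j + 1) * n / s). *)
Definition dyadic_bound (n s j : nat) : comp nat :=
  x <- imul j n ;; y <- iadd x s ;; z <- isub y 1 ;; idiv z s.

(** The output of each patch consists of (s, j1, j2), where s = 2 ^ i, and of an
    approximation: nine words (the stream being given by its address). *)
Definition emit (T : Type) (out : seq T) (x : T) : comp (seq T) :=
  op 9 (x :: out).

Definition fast_level (R : realType) (rho : raster R) (n : nat) (img : 'M[R]_n)
    (s : nat) (out : seq (nat * nat * nat * approx R)) :
    comp (seq (nat * nat * nat * approx R)) :=
  for_ 0 s (fun j1 => for_ 0 s (fun j2 out =>
    j1' <- iadd j1 1 ;;
    j2' <- iadd j2 1 ;;
    lo1 <- dyadic_bound n s j1 ;;
    hi1 <- dyadic_bound n s j1' ;;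
    lo2 <- dyadic_bound n s j2 ;;
    hi2 <- dyadic_bound n s j2' ;;
    m <- isub hi1 lo1 ;;
    m' <- isub hi2 lo2 ;;
    r <- fast_patch rho img lo1 lo2 m m' ;;
    emit out (s, j1, j2, r))) out.

(** The levels i with 2 ^ i <= n, i.e. i <= log2 n. *)
Definition fast_image (R : realType) (rho : raster R) (n : nat)
    (img : 'M[R]_n) : comp (nat * seq (nat * nat * nat * approx R)) :=
  loop (fun '(s, out) =>
    b <- ile s n ;;
    if b then
      out' <- fast_level rho img s out ;;
      s' <- imul 2 s ;;
      ret ((s', out'), true)
    else ret ((s, out), false))
  (1%N, [::]).

(* Main.v *)
(* With M the larger side of a patch, one orientation costs O(M^2): O(M^2) for the
   line sums and O(M) for each of the at most kappa M selection steps.  The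
   hypothesis on kappa applies because the arrays and aggregates stored by the
   program are exactly the quantities S_i, N_i, SC, NC and err, so that the
   rounds of its loop are the selection steps; the loop ends because the error
   decreases strictly and there are finitely many streams.  There are at most 2M
   orientations, so a patch costs O(M^3).  Level s = 2^i consists of s^2 patches
   with s M <= 2n, hence costs O(n^3 / s), and these costs form a geometric
   series. *)

Require Import Defs.
From mathcomp Require Import all_boot all_order all_algebra.
From mathcomp Require Import reals.
From mathcomp Require Import zify ring lra.
Import Defs. (* [comp] is also a name of ssrfun *)

Import Order.TTheory GRing.Theory Num.Theory.
Local Open Scope ring_scope.

Set Implicit Arguments.
Unset Strict Implicit.
Unset Printing Implicit Defensive.

(** * Total-correctness rules for timed computations *)

(** The existence clause rules out computations that diverge or get stuck: these have no outcome and
    would satisfy any universal bound. It is also half of [runs_within]. *)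
Definition wp (A : Type) (c : comp A) (P : A -> nat -> Prop) : Prop :=
  (exists a t, c a t) /\ forall a t, c a t -> P a t.

Lemma wp_mono (A : Type) (c : comp A) (P Q : A -> nat -> Prop) :
  wp c P -> (forall a t, P a t -> Q a t) -> wp c Q.
Proof. by move=> [ex cP] PQ; split=> // a t /cP /PQ. Qed.

Lemma wp_op (A : Type) (k : nat) (a : A) (P : A -> nat -> Prop) :
  P a k -> wp (op k a) P.
Proof. by move=> Pak; split; [exists a, k | move=> _ _ [-> ->]]. Qed.

Lemma wp_bind (A B : Type) (c : comp A) (f : A -> comp B)
    (P : B -> nat -> Prop) :
  wp c (fun a t => wp (f a) (fun b t' => P b (t + t')%N)) -> wp (bind c f) P.
Proof.
move=> [[a [t cat]] cP]; split.
  have [[b [t' fabt']] _] := cP _ _ cat.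
  by exists b, (t + t')%N, a, t, t'.
move=> b u [a' [t1 [t2 [ct1 ft2 ->]]]].
by have [_] := cP _ _ ct1; apply.
Qed.

Lemma wp_bind_op (A B : Type) (k : nat) (a : A) (f : A -> comp B)
    (P : B -> nat -> Prop) :
  wp (f a) (fun b t => P b (k + t)%N) -> wp (bind (op k a) f) P.
Proof. by move=> H; apply/wp_bind/wp_op. Qed.

Lemma wp_aread (T : Type) (x0 : T) (a : seq T) (i : nat)
    (P : T -> nat -> Prop) :
  (i < size a)%N -> P (nth x0 a i) 1%N -> wp (aread a i) P.
Proof.
move=> lti Pi; have a_i : onth a i = Some (nth x0 a i).
  by rewrite onthE (nth_map x0).
split; first by exists (nth x0 a i), 1%N.
by move=> v t [+ ->]; rewrite a_i => -[<-].
Qed.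

(** [awrite] uses the written value as the default of [set_nth]; within bounds no padding occurs, so
    any default gives the same array. *)
Lemma wp_awrite (T : Type) (x0 : T) (a : seq T) (i : nat) (v : T)
    (P : seq T -> nat -> Prop) :
  (i < size a)%N -> P (set_nth x0 a i v) 1%N -> wp (awrite a i v) P.
Proof.
move=> lti Pi; have E : set_nth v a i v = set_nth x0 a i v.
  apply: (@eq_from_nth _ x0) => [|j]; first by rewrite !size_set_nth.
  rewrite size_set_nth => ltj; rewrite nth_set_nth (set_nth_default v) /=.
    by rewrite nth_set_nth /=; case: eqP => // _; apply: set_nth_default; lia.
  by rewrite size_set_nth; lia.
rewrite -E in Pi.
by split; [exists (set_nth v a i v), 1%N | move=> b t [_ -> ->]].
Qed.

(** Totalized by 0 outside the matrix, so that shifted indices and sums over ranges of naturals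
    carry no bound proofs. *)
Definition entry (R : realType) (m m' : nat) (A : 'M[R]_(m, m')) (x y : nat) : R :=
  if insub x is Some i then if insub y is Some j then A i j else 0 else 0.

Lemma entryE (R : realType) (m m' : nat) (A : 'M[R]_(m, m'))
    (x : 'I_m) (y : 'I_m') :
  entry A x y = A x y.
Proof. by rewrite /entry !valK. Qed.

Lemma wp_mread (R : realType) (m m' : nat) (A : 'M[R]_(m, m')) (x y : nat)
    (P : R -> nat -> Prop) :
  (x < m)%N -> (y < m')%N -> P (entry A x y) 1%N -> wp (mread A x y) P.
Proof.
move=> ltx lty; have /= -> := entryE A (Ordinal ltx) (Ordinal lty) => PA; split.
  by exists (A (Ordinal ltx) (Ordinal lty)), 1%N, (Ordinal ltx), (Ordinal lty).
move=> _ _ [i [j [ix jy -> ->]]].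
have -> : i = Ordinal ltx by apply: val_inj; exact: ix.
by have -> : j = Ordinal lty by apply: val_inj; exact: jy.
Qed.

Lemma wp_rdiv (R : realType) (a b : R) (P : R -> nat -> Prop) :
  b != 0 -> P (a / b) 1%N -> wp (rdiv a b) P.
Proof. by move=> b0 Pab; split; [exists (a / b), 1%N | move=> _ _ [_ -> ->]]. Qed.

Lemma wp_idiv (a b : nat) (P : nat -> nat -> Prop) :
  (0 < b)%N -> P (a %/ b)%N 1%N -> wp (idiv a b) P.
Proof. by move=> b0 Pab; split; [exists (a %/ b)%N, 1%N | move=> _ _ [_ -> ->]]. Qed.

(** Invariant rule: [T] bounds every round, 2 is the charge per round and 1 that of the exit
    test. *)
Lemma wp_for (S : Type) (lo hi T : nat) (body : nat -> S -> comp S)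
    (I : nat -> S -> Prop) (s : S) :
  (lo <= hi)%N -> I lo s ->
  (forall i u, (lo <= i < hi)%N -> I i u ->
     wp (body i u) (fun v t => (t <= T)%N /\ I i.+1 v)) ->
  wp (for_ lo hi body s)
     (fun v t => (t <= (hi - lo) * (T + 2) + 1)%N /\ I hi v).
Proof.
rewrite /for_; have [k Ek] : exists k, k = (hi - lo)%N by exists (hi - lo)%N.
rewrite -Ek; elim: k lo s Ek => [|k IHk] lo s Ek le_lo Is step.
  by apply: wp_op; split=> //; have -> : hi = lo by lia.
apply/wp_bind_op/wp_bind/wp_mono.
  by apply: step Is; lia.
move=> v t [let_ Iv] /=; apply: wp_mono.
  by apply: IHk Iv _ => [||i u ltiu]; [lia | lia | apply: step; lia].
by move=> u t' [let' Iu]; split=> //; lia.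
Qed.

(** A single unfolding; each use supplies its own induction for termination. *)
Lemma wp_loop (S : Type) (body : S -> comp (S * bool)) (s : S)
    (P : S -> nat -> Prop) :
  wp (body s) (fun r t =>
    if r.2 then wp (loop body r.1) (fun u t' => P u (t + t')%N) else P r.1 t) ->
  wp (loop body s) P.
Proof.
move=> [[[s1 b] [t cst]] bodyP]; split.
  case: b cst => cst; last by exists s1, t; apply: loop_stop.
  have /= [[u [t' lu]] _] := bodyP _ _ cst.
  by exists u, (t + t')%N; apply: loop_next lu.
move=> u t' l; case: l bodyP => [s' s2 t1 b1 | s' s2 s3 t1 t2 b1 l1] bodyP.
  exact: (bodyP _ _ b1).
by have /= [_] := bodyP _ _ b1; apply.
Qed.

(** * The line sums of a patch, computed in one scan *)

Definition patch (R : realType) (n : nat) (img : 'M[R]_n) (lo1 lo2 m m' : nat) :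
    'M[R]_(m, m') :=
  \matrix_(x < m, y < m') entry img (lo1 + x) (lo2 + y).

(* The sum of [F] over the pixels that precede (x, y) in the row-major order of
   a patch with rows of length [m']. *)
Definition scan (V : nmodType) (m' : nat) (F : nat -> nat -> V) (x y : nat) : V :=
  \sum_(0 <= x' < x) \sum_(0 <= y' < m') F x' y' + \sum_(0 <= y' < y) F x y'.

Lemma scan00 (V : nmodType) (m' : nat) (F : nat -> nat -> V) : scan m' F 0 0 = 0.
Proof. by rewrite /scan !big_geq // addr0. Qed.

Lemma scanS (V : nmodType) (m' : nat) (F : nat -> nat -> V) (x y : nat) :
  scan m' F x y.+1 = scan m' F x y + F x y.
Proof. by rewrite /scan big_nat_recr //= addrA. Qed.

Lemma scan_row (V : nmodType) (m' : nat) (F : nat -> nat -> V) (x : nat) :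
  scan m' F x m' = scan m' F x.+1 0.
Proof. by rewrite /scan [in RHS]big_nat_recr //= [X in _ = _ + X]big_geq ?addr0. Qed.

Lemma scan_ord (V : nmodType) (m m' : nat) (F : nat -> nat -> V) :
  scan m' F m 0 = \sum_(x < m) \sum_(y < m') F x y.
Proof.
rewrite /scan [X in _ + X]big_geq ?addr0 // big_mkord.
by apply: eq_bigr => x _; rewrite big_mkord.
Qed.

(** Only lower bounds on the sizes: the arrays are allocated with m + m' cells before the number of
    lines is known. *)
Definition tables (R : realType) (rho : raster R) (m m' : nat) (w : 'M[R]_(m, m'))
    (O : nat * nat) (Sa Na : seq R) : Prop :=
  [/\ (nlines rho m m' O <= size Sa)%N, (nlines rho m m' O <= size Na)%N &
      forall i, (i < nlines rho m m' O)%N ->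
        nth 0 Sa i = S_ rho w O i /\ nth 0 Na i = (N_ rho m m' O i)%:R].

Lemma nlines_leD (R : realType) (rho : raster R) (m m' : nat) (O : nat * nat) :
  (0 < m)%N -> (0 < m')%N -> D_O m m' O -> (nlines rho m m' O <= m + m')%N.
Proof.
move=> m0 m'0 DO; rewrite -(ler_nat R); apply: le_trans (nlines_le rho m0 m'0 DO) _.
rewrite -[leRHS]ger0_norm // -sqrtr_sqr ler_sqrt ?sqr_ge0 // natrD sqrrD.
have : 0 <= m%:R * m'%:R *+ 2 :> R by rewrite -natrM mulrn_wge0.
by lra.
Qed.

Lemma nlines_gt0 (R : realType) (rho : raster R) (m m' : nat) (O : nat * nat) :
  (0 < m)%N -> (0 < m')%N -> D_O m m' O -> (0 < nlines rho m m' O)%N.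
Proof. by move=> m0 m'0 DO; apply: leq_ltn_trans (line_lt rho DO m0 m'0). Qed.

Lemma wp_line_sums (R : realType) (rho : raster R) (n : nat) (img : 'M[R]_n)
    (lo1 lo2 m m' K : nat) (O : nat * nat) :
  (0 < m)%N -> (0 < m')%N -> (lo1 + m <= n)%N -> (lo2 + m' <= n)%N ->
  D_O m m' O ->
  (forall x y, (x < m)%N -> (y < m')%N -> (line_cost rho m m' O x y <= K)%N) ->
  let w := patch img lo1 lo2 m m' in
  wp (line_sums rho img lo1 lo2 m m' O) (fun r t =>
    let '(Sa, Na, p, tot, q) := r in
    [/\ (t <= m * (m' * (K + 16) + 3) + 2 * (m + m') + 2)%N,
        tables rho w O Sa Na, p = nlines rho m m' O,
        tot = \sum_(x < m) \sum_(y < m') w x y &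
        q = \sum_(x < m) \sum_(y < m') w x y ^+ 2]).
Proof.
move=> m0 m'0 le1 le2 DO leK w.
set N := nlines rho m m' O; have leN : (N <= m + m')%N by exact: nlines_leD.
pose f x y := entry img (lo1 + x) (lo2 + y).
pose ln := line rho m m' O.
(* Before pixel (x, y), every cell holds a sum over the scanned pixels, and [p] exceeds the index of
   each line met so far without exceeding [N]. *)
pose inv x y (s : seq R * seq R * nat * R * R) := let '(Sa, Na, p, tot, q) := s in
  [/\ [/\ size Sa = (m + m')%N, size Na = (m + m')%N & forall i, (i < N)%N ->
         nth 0 Sa i = scan m' (fun x y => if ln x y == i then f x y else 0) x y /\
         nth 0 Na i = scan m' (fun x y => if ln x y == i then 1 else 0) x y],
      (p <= N)%N,
      forall x' y', (y' < m')%N -> (x' < x)%N || (x' == x) && (y' < y)%N ->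
        (ln x' y' < p)%N,
      tot = scan m' f x y &
      q = scan m' (fun x y => f x y ^+ 2) x y].
rewrite /line_sums; do 3 apply: wp_bind_op.
apply: wp_mono.
  apply: (@wp_for _ 0 m (m' * (K + 16) + 1)%N _ (fun x s => inv x 0%N s)) => //.
    split; rewrite ?scan00 //.
      by split=> [||i ltiN]; rewrite ?size_nseq // !nth_nseq !if_same !scan00.
    by move=> x' y' _; rewrite ltn0 andbF.
  move=> x s /andP[_ ltx] invs; apply: wp_mono.
    (* Fourteen unit operations besides [line_index]. *)
    apply: (@wp_for _ 0 m' (K + 14)%N _ (inv x)) invs _ => //.
    move=> y {}s /andP[_ lty].
    case: s => -[[[Sa Na] p] tot] q [[szS szN tab] lepN ltp -> ->].
    have ltlN : (ln x y < N)%N := line_lt rho DO ltx lty.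
    have ltlD : (ln x y < m + m')%N by exact: leq_trans leN.
    do 3 apply: wp_bind_op.
    apply/wp_bind/wp_mread; try lia.
    apply/wp_bind/(@wp_aread _ 0); first by rewrite szS.
    apply/wp_bind_op/wp_bind/(@wp_awrite _ 0); first by rewrite szS.
    apply/wp_bind/(@wp_aread _ 0); first by rewrite szN.
    apply/wp_bind_op/wp_bind/(@wp_awrite _ 0); first by rewrite szN.
    do 5 apply: wp_bind_op; apply: wp_op; rewrite -/(ln x y).
    split; first by have := leK _ _ ltx lty; lia.
    split; rewrite ?scanS //.
    - split=> [||i ltiN]; rewrite ?size_set_nth ?szS ?szN ?(maxn_idPr ltlD) //.
      rewrite !nth_set_nth /= !scanS; have [-> ->] := tab _ ltiN.
      have [-> ->] := tab _ ltlN; rewrite eq_sym.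
      by case: eqP => [->|_]; rewrite ?addr0.
    - by case: ifP; lia.
    - move=> x' y' lty' before.
      have [/andP[/eqP -> /eqP ->]|ne] := boolP ((x' == x) && (y' == y)).
        by case: ifP; lia.
      have ltp' : (ln x' y' < p)%N by apply: ltp => //; lia.
      by case: ifP; lia.
  case=> -[[[Sa Na] p] tot] q t [let_ [[szS szN tab] lepN ltp -> ->]].
  split; first by lia.
  split; rewrite -?scan_row //.
    by split=> // i /tab [-> ->]; rewrite !scan_row.
  by move=> x' y' lty' before; apply: ltp => //; lia.
case=> -[[[Sa Na] p] tot] q t [let_ [[szS szN tab] lepN ltp -> ->]].
rewrite !scan_ord; split.
- by lia.
- split; rewrite ?szS ?szN // => i /tab [-> ->]; rewrite !scan_ord; split.
    apply: eq_bigr => x _; rewrite [RHS]big_mkcond /=; apply: eq_bigr => y _.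
    by rewrite mxE.
  rewrite natr_sum; apply: eq_bigr => x _.
  rewrite natr_sum [RHS]big_mkcond /=; apply: eq_bigr => y _.
  by rewrite -/(ln x y).
(* The last line, of index [N.-1], contains a pixel; that pixel has been scanned, so [p] is at least
   [N]. *)
- apply/eqP; rewrite eqn_leq lepN /=.
  have N0 : (0 < N)%N by exact: nlines_gt0.
  have [//|x [y [ltx lty lnN]]] := @line_onto _ rho m m' O N.-1 m0 m'0 DO.
    by rewrite -/N prednK.
  have := ltp x y lty; rewrite ltx /= /ln lnN prednK //; exact.
- by apply: eq_bigr => x _; apply: eq_bigr => y _; rewrite mxE.
- by apply: eq_bigr => x _; apply: eq_bigr => y _; rewrite mxE.
Qed.

(** * Aggregates of a stream and the initial state *)

Lemma N_gt0 (R : realType) (rho : raster R) (m m' : nat) (O : nat * nat) (i : nat) :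
  (0 < m)%N -> (0 < m')%N -> D_O m m' O -> (i < nlines rho m m' O)%N ->
  (0 < N_ rho m m' O i)%N.
Proof.
move=> m0 m'0 DO ltiN; have [x [y [ltx lty lnE]]] := line_onto m0 m'0 DO ltiN.
rewrite /N_ (bigD1 (Ordinal ltx)) //= (bigD1 (Ordinal lty)) //=.
by rewrite lnE.
Qed.

(** Only the term [k] changes class: it leaves class [c] if it was there and enters it otherwise.
    Subtraction needs a group, hence the counts are used as reals. *)
Lemma sum_flip (V : zmodType) (p : nat) (G : p.-tuple bool) (k : 'I_p) (c : bool)
    (F : 'I_p -> V) :
  \sum_(i | tnth (flip G k) i == c) F i =
  if tnth G k == c then \sum_(i | tnth G i == c) F i - F k
  else \sum_(i | tnth G i == c) F i + F k.
Proof.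
rewrite big_mkcond (bigD1 k) //= tnth_mktuple eqxx.
rewrite (_ : (if tnth G k == c then _ else _) =
  (if tnth G k == c then 0 else F k) +
  \sum_(i | i != k) if tnth G i == c then F i else 0).
  congr (_ + _); first by case: (tnth G k) c => -[].
  by apply: eq_bigr => i /negPf ik; rewrite tnth_mktuple ik.
rewrite big_mkcond (bigD1 k) //=.
case: (tnth G k == c); last by rewrite add0r addrC.
by rewrite addrAC subrr.
Qed.

Lemma NCE (R : realType) (rho : raster R) (m m' : nat) (O : nat * nat) (c : bool)
    (G : stream rho m m' O) :
  (NC c G)%:R = \sum_(i | tnth G i == c) (N_ rho m m' O i)%:R :> R.
Proof. by rewrite /NC natr_sum. Qed.

Definition stats_of (R : realType) (rho : raster R) (m m' : nat) (w : 'M[R]_(m, m'))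
    (O : nat * nat) (G : stream rho m m' O) : stats R :=
  Stats (SC w false G) (NC false G)%:R (SC w true G) (NC true G)%:R.

Lemma wp_flip_stats (R : realType) (rho : raster R) (m m' : nat)
    (w : 'M[R]_(m, m')) (O : nat * nat) (Sa Na : seq R) (G : stream rho m m' O)
    (k : 'I_(nlines rho m m' O)) :
  tables rho w O Sa Na ->
  wp (flip_stats Sa Na G (stats_of w G) k) (fun st t =>
    (t <= 7)%N /\ st = stats_of w (flip G k : stream rho m m' O)).
Proof.
case=> szS szN /(_ k (ltn_ord k)) [Sk Nk].
have flipE := (fun c => sum_flip G k c (fun i => S_ rho w O i),
               fun c => sum_flip G k c (fun i => (N_ rho m m' O i)%:R : R)).
apply/wp_bind/(@wp_aread _ false); first by rewrite size_tuple.
apply/wp_bind/(@wp_aread _ 0); first exact: leq_trans szS.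
apply/wp_bind/(@wp_aread _ 0); first exact: leq_trans szN.
rewrite Sk Nk -tnth_nth /stats_of /SC !NCE !flipE.
by case: (tnth G k) => /=; do 4 apply: wp_bind_op; apply: wp_op.
Qed.

Lemma wp_initial_state (R : realType) (rho : raster R) (m m' : nat)
    (w : 'M[R]_(m, m')) (O : nat * nat) (Sa Na : seq R) :
  (0 < m)%N -> (0 < m')%N -> D_O m m' O -> tables rho w O Sa Na ->
  wp (initial_state Sa Na (nlines rho m m' O)
        ((\sum_(x < m) \sum_(y < m') w x y) / (m * m')%:R)) (fun r t =>
    (t <= 10 * nlines rho m m' O + 1)%N /\
    r = (tval (G0 rho w O), stats_of w (G0 rho w O))).
Proof.
move=> m0 m'0 DO [szS szN tab]; set N := nlines rho m m' O; set cm := _ / _.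
pose S i := S_ rho w O i; pose Ni i : R := (N_ rho m m' O i)%:R.
pose g i := S i / Ni i < cm.
pose psum F c i : R := \sum_(0 <= j < i | g j == c) F j.
(* After [i] rounds the first [i] bits are final and the aggregates are those of the first [i]
   lines. *)
pose inv i (s : seq bool * stats R) :=
  [/\ size s.1 = N, forall j, (j < i)%N -> nth false s.1 j = g j &
      s.2 = Stats (psum S false i) (psum Ni false i) (psum S true i) (psum Ni true i)].
have psumS F c i : psum F c i.+1 = psum F c i + (if g i == c then F i else 0).
  by rewrite /psum big_mkcond big_nat_recr //= -big_mkcond.
apply: wp_bind_op; apply: wp_mono.
  apply: (@wp_for _ 0 N 7%N _ inv) => //.
    by split; rewrite ?size_nseq // /psum !big_geq.
  move=> i [G st] /andP[_ ltiN] [/= szG nthG ->]; have [Si NiE] := tab _ ltiN.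
  apply/wp_bind/(@wp_aread _ 0); first exact: leq_trans szS.
  apply/wp_bind/(@wp_aread _ 0); first exact: leq_trans szN.
  rewrite Si NiE -/(S i) -/(Ni i).
  apply/wp_bind/wp_rdiv.
    by rewrite pnatr_eq0 -lt0n N_gt0.
  apply/wp_bind_op/wp_bind/(@wp_awrite _ false); rewrite -/(g i) ?szG //.
  have nthG' j : (j < i.+1)%N -> nth false (set_nth false G i (g i)) j = g j.
    by rewrite nth_set_nth /=; case: eqP => [-> //|/eqP ne] ltj; apply: nthG; lia.
  have szG' : size (set_nth false G i (g i)) = N.
    by rewrite size_set_nth szG (maxn_idPr ltiN).
  case Eg: (g i) nthG' szG' => nthG' szG'; do 2 apply: wp_bind_op; apply: wp_op;
    by split=> //; split; rewrite // !psumS Eg /= ?addr0.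
case=> G st t [let_ [/= szG nthG ->]]; split; first by lia.
have G0E (i : 'I_N) : tnth (G0 rho w O) i = g i by rewrite tnth_mktuple.
have psumE F c : psum F c N = \sum_(i < N | tnth (G0 rho w O) i == c) F i.
  by rewrite /psum big_mkord; apply: eq_bigl => i; rewrite G0E.
rewrite !psumE /stats_of !NCE; suff -> : G = tval (G0 rho w O) by [].
apply: (@eq_from_nth _ false); rewrite szG ?size_tuple // => i ltiN.
by rewrite nthG // -(G0E (Ordinal ltiN)) (tnth_nth false).
Qed.

(** * The error as a function of the aggregates *)

(** The lines partition the patch. [H] takes the line index separately, so that a gray level
    depending on the line becomes constant in the inner sums. *)
Lemma sum_lines (R : realType) (rho : raster R) (m m' : nat) (O : nat * nat)
    (V : nmodType) (H : nat -> 'I_m -> 'I_m' -> V) :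
  D_O m m' O ->
  \sum_(x < m) \sum_(y < m') H (line rho m m' O x y) x y =
  \sum_(i < nlines rho m m' O)
    \sum_(x < m) \sum_(y < m' | line rho m m' O x y == i) H i x y.
Proof.
move=> DO; rewrite [RHS]exchange_big; apply: eq_bigr => x _ /=.
under [RHS]eq_bigr do rewrite big_mkcond /=.
rewrite [RHS]exchange_big; apply: eq_bigr => y _ /=.
rewrite -big_mkcond (big_pred1 (Ordinal (line_lt rho DO (ltn_ord x) (ltn_ord y)))) //=.
Qed.

(** If the count is 0, the class contains no line, since lines are nonempty; then [SC] is 0 as well
    and agrees with the default gray level 0. *)
Lemma gray_mul_NC (R : realType) (rho : raster R) (m m' : nat)
    (w : 'M[R]_(m, m')) (O : nat * nat) (c : bool) (G : stream rho m m' O) :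
  (0 < m)%N -> (0 < m')%N -> D_O m m' O ->
  gray w c G * (NC c G)%:R = SC w c G.
Proof.
move=> m0 m'0 DO; rewrite /gray; case: eqP => [NC0|/eqP NC0]; last first.
  by rewrite divfK // pnatr_eq0.
rewrite mul0r /SC big1 // => i Gi.
have /eqP := NC0; rewrite /NC sum_nat_eq0 => /forallP/(_ i).
by rewrite Gi eqn0Ngt N_gt0.
Qed.

(** Expanding the square, a class of gray level c contributes -2 c SC + c^2 NC beyond the sum of
    squares, which is -c SC because c NC = SC. This is the quantity that [error] computes. *)
Lemma errE (R : realType) (rho : raster R) (m m' : nat)
    (w : 'M[R]_(m, m')) (O : nat * nat) (G : stream rho m m' O) :
  (0 < m)%N -> (0 < m')%N -> D_O m m' O ->
  err w G = (\sum_(x < m) \sum_(y < m') w x y ^+ 2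
             - gray w false G * SC w false G - gray w true G * SC w true G)
            / (m * m')%:R.
Proof.
move=> m0 m'0 DO; congr (_ / _).
pose c i := gray w (nth false G i) G.
have -> : \sum_(x < m) \sum_(y < m') (w x y - psml w G x y) ^+ 2 =
    \sum_(x < m) \sum_(y < m') w x y ^+ 2 +
    \sum_(x < m) \sum_(y < m') (- (c (line rho m m' O x y) * w x y) *+ 2 +
      c (line rho m m' O x y) ^+ 2).
  rewrite -big_split; apply: eq_bigr => x _; rewrite -big_split.
  by apply: eq_bigr => y _ /=; rewrite mxE -/(c _); ring.
rewrite (sum_lines rho (fun i x y => - (c i * w x y) *+ 2 + c i ^+ 2)) //=.
have line_sum i : \sum_(x < m) \sum_(y < m' | line rho m m' O x y == i)
    (- (c i * w x y) *+ 2 + c i ^+ 2) =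
    - (c i * S_ rho w O i) *+ 2 + c i ^+ 2 * (N_ rho m m' O i)%:R.
  rewrite /S_ /N_ natr_sum !mulr_sumr -sumrN -sumrMnl -big_split.
  apply: eq_bigr => x _ /=.
  rewrite natr_sum !mulr_sumr -sumrN -sumrMnl -big_split.
  apply: eq_bigr => y _ /=.
  by rewrite mulr1.
rewrite (eq_bigr _ (fun i _ => line_sum (val i))).
have class_sum b : \sum_(i < nlines rho m m' O | tnth G i == b)
    (- (c i * S_ rho w O i) *+ 2 + c i ^+ 2 * (N_ rho m m' O i)%:R) =
    - (gray w b G * SC w b G).
  transitivity (- (gray w b G * SC w b G) *+ 2 + gray w b G ^+ 2 * (NC b G)%:R).
    rewrite NCE /SC !mulr_sumr -sumrN -sumrMnl -big_split.
    apply: eq_bigr => i /eqP Gi /=.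
    by rewrite /c -tnth_nth Gi.
  by rewrite expr2 -mulrA gray_mul_NC //; ring.
rewrite (bigID (fun i => tnth G i == false)) /= class_sum.
rewrite (eq_bigl (fun i => tnth G i == true)); last by move=> i; case: (tnth G i).
by rewrite class_sum addrA.
Qed.

Lemma wp_gray_level (R : realType) (rho : raster R) (m m' : nat)
    (w : 'M[R]_(m, m')) (O : nat * nat) (c : bool) (G : stream rho m m' O) :
  wp (gray_level (SC w c G) (NC c G)%:R) (fun v t => (t <= 2)%N /\ v = gray w c G).
Proof.
apply: wp_bind_op; rewrite pnatr_eq0 /gray; case: ifP => [_|/negbT NC0].
  exact: wp_op.
by apply: wp_rdiv; rewrite ?pnatr_eq0.
Qed.

Lemma wp_error (R : realType) (rho : raster R) (m m' : nat)
    (w : 'M[R]_(m, m')) (O : nat * nat) (G : stream rho m m' O) :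
  (0 < m)%N -> (0 < m')%N -> D_O m m' O ->
  wp (error (\sum_(x < m) \sum_(y < m') w x y ^+ 2) (m * m')%:R (stats_of w G))
     (fun e t => (t <= 9)%N /\ e = err w G).
Proof.
move=> m0 m'0 DO; apply/wp_bind/wp_mono; first exact: wp_gray_level.
move=> _ t1 [let1 ->]; apply/wp_bind/wp_mono; first exact: wp_gray_level.
move=> _ t2 [let2 ->]; do 4 apply: wp_bind_op.
apply: wp_rdiv; first by rewrite pnatr_eq0 muln_eq0 negb_or -!lt0n m0 m'0.
by split; [lia | rewrite errE].
Qed.

(** * The selection step and its repetition *)

Lemma wp_selection_step (R : realType) (rho : raster R) (m m' : nat)
    (w : 'M[R]_(m, m')) (O : nat * nat) (Sa Na : seq R) (G : stream rho m m' O) :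
  (0 < m)%N -> (0 < m')%N -> D_O m m' O -> tables rho w O Sa Na ->
  let N := nlines rho m m' O in
  let q := \sum_(x < m) \sum_(y < m') w x y ^+ 2 in
  let state (H : stream rho m m' O) := (tval H, stats_of w H, err w H) in
  wp (selection_step Sa Na N q (m * m')%:R (state G)) (fun r t =>
    (t <= 19 * N + 28)%N /\
    exists k : 'I_N, selected w G k /\
      let G' : stream rho m m' O := flip G k in
      r = if err w G' < err w G then (state G', true) else (state G, false)).
Proof.
move=> m0 m'0 DO tab N q state; have N0 : (0 < N)%N by exact: nlines_gt0.
pose e (k : 'I_N) := err w (flip G k : stream rho m m' O).
rewrite /selection_step /state; set st := stats_of w G; set a := (m * m')%:R.
apply/wp_bind/wp_mono; first exact: (wp_flip_stats G (Ordinal N0) tab).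
move=> _ t1 [let1 ->]; apply/wp_bind/wp_mono; first exact: wp_error.
move=> _ t2 [let2 ->]; apply/wp_bind/wp_mono.
  (* [best] holds the lowest-index minimizer among the neighbors before [j]: only a strictly lower
     error replaces it, which is the tie rule of [selected]. A round costs 7 for the aggregates, 9
     for the error and 1 for the comparison. *)
  apply: (@wp_for _ 1 N 17%N _ (fun j (best : nat * R) => exists k : 'I_N,
    [/\ (k < j)%N, best = (val k, e k) &
        forall i : 'I_N, (i < j)%N -> e k <= e i /\ ((i < k)%N -> e k < e i)])) => //.
    exists (Ordinal N0); split=> // i; rewrite ltnS leqn0 => /eqP i0.
    by have -> : i = Ordinal N0 by apply: val_inj; exact: i0.
  move=> j best /andP[lt0j ltjN] [k [ltkj -> kP]].
  apply/wp_bind/wp_mono; first exact: (wp_flip_stats G (Ordinal ltjN) tab).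
  move=> _ t3 [let3 ->]; apply/wp_bind/wp_mono; first exact: wp_error.
  move=> _ t4 [let4 ->]; apply/wp_bind_op/wp_op; split; first by lia.
  rewrite -/(e _) /=.
  have split_lt (i : 'I_N) : (i < j.+1)%N -> (i < j)%N \/ i = Ordinal ltjN.
    rewrite ltnS leq_eqVlt => /orP[/eqP Ei|]; last by left.
    by right; apply: val_inj.
  case: ltP => cmp.
    exists (Ordinal ltjN); split=> // i /split_lt[lti|-> //].
      have [leki _] := kP _ lti; have lti' := lt_le_trans cmp leki.
      by split=> // ; exact: ltW.
    by rewrite ltnn.
  exists k; split=> //; first exact: ltnW.
  move=> i /split_lt[lti|->]; first exact: kP.
  by split=> //= ltjk; move: (ltn_trans ltjk ltkj); rewrite ltnn.
move=> _ t3 [let3 [k [_ -> kP]]]; apply: wp_bind_op.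
have selk : selected w G k.
  by split=> j; [have [] := kP j (ltn_ord j) | move=> ltjk; apply: (kP j (ltn_ord j)).2].
have nthk : nth false G k = tnth G k by rewrite -tnth_nth.
case: ifP => improves; last first.
  apply: wp_op; split; first by lia.
  by exists k; rewrite -/(e k) improves.
apply/wp_bind/wp_mono; first exact: (wp_flip_stats G k tab).
move=> _ t4 [let4 ->].
apply/wp_bind/(@wp_aread _ false); first by rewrite size_tuple; exact: ltn_ord.
apply: wp_bind_op; apply/wp_bind/(@wp_awrite _ false).
  by rewrite size_tuple; exact: ltn_ord.
apply: wp_op; split; first by lia.
exists k; split=> //=; rewrite -/(e k) improves.
suff -> : set_nth false G k (~~ nth false G k) = tval (flip G k) by [].
apply: (@eq_from_nth _ false); rewrite size_set_nth !size_tuple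
  (maxn_idPr (ltn_ord k)) //.
move=> i lti; rewrite nth_set_nth /= -(tnth_nth _ _ (Ordinal lti)).
rewrite -[RHS](tnth_nth false (flip G k) (Ordinal lti)) tnth_mktuple nthk.
rewrite -val_eqE /=; case: eqP => [Ei|_]; last by rewrite (tnth_nth false).
by congr (~~ tnth G _); apply: val_inj.
Qed.

(** Induction on the number of streams with error below the current one. Termination is thus
    independent of the assumed bound on the rounds; the time is expressed through their exact number
    [r]. *)
Lemma wp_selection_loop (R : realType) (rho : raster R) (m m' : nat)
    (w : 'M[R]_(m, m')) (O : nat * nat) (Sa Na : seq R) (G : stream rho m m' O) :
  (0 < m)%N -> (0 < m')%N -> D_O m m' O -> tables rho w O Sa Na ->
  let N := nlines rho m m' O in
  let q := \sum_(x < m) \sum_(y < m') w x y ^+ 2 in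
  wp (loop (selection_step Sa Na N q (m * m')%:R) (tval G, stats_of w G, err w G))
    (fun s t => exists r (H : stream rho m m' O),
      [/\ selections w G r, (t <= r * (19 * N + 28))%N &
          s = (tval H, stats_of w H, err w H)]).
Proof.
move=> m0 m'0 DO tab N q.
have [b] := ubnP #|[set H : stream rho m m' O | err w H < err w G]|.
elim: b G => // b IHb G ltb; apply/wp_loop/wp_mono; first exact: wp_selection_step.
move=> s t [let_ [k [selk ->]]].
case improves: (err w (flip G k : stream rho m m' O) < err w G) => /=; last first.
  exists 1%N, G; split; rewrite ?mul1n //.
  by apply: (selections_stop selk); rewrite improves.
apply: wp_mono; first apply: (IHb (flip G k : stream rho m m' O)).
  rewrite -ltnS; apply: leq_trans ltb; rewrite ltnS; apply/proper_card/properP; split.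
    by apply/subsetP => H; rewrite !inE => /lt_trans; apply.
  (* The new state itself witnesses the strict decrease: it lies below the old error but not below
     its own. *)
  by exists (flip G k); rewrite !inE ?ltxx.
move=> u t' [r [H [selr let' ->]]].
by exists r.+1, H; split; [by apply: (selections_next selk) | rewrite mulSn; lia |].
Qed.

(** * Cost of one orientation and of one patch *)

Lemma wp_fast_orientation (R : realType) (rho : raster R) (n : nat) (img : 'M[R]_n)
    (lo1 lo2 m m' M K kappa : nat) (O : nat * nat) :
  (0 < m <= M)%N -> (0 < m' <= M)%N -> (lo1 + m <= n)%N -> (lo2 + m' <= n)%N ->
  D_O m m' O ->
  (forall x y, (x < m)%N -> (y < m')%N -> (line_cost rho m m' O x y <= K)%N) ->
  (forall (w : 'M[R]_(m, m')) r, selections w (G0 rho w O) r -> (r <= kappa * M)%N) ->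
  wp (fast_orientation rho img lo1 lo2 m m' O)
     (fun _ t => (t <= (K + 66 * kappa + 70) * M ^ 2)%N).
Proof.
move=> /andP[m0 lem] /andP[m'0 lem'] le1 le2 DO leK le_kappa.
have leN := nlines_leD rho m0 m'0 DO.
apply/wp_bind/wp_mono; first exact: (wp_line_sums img m0 m'0 le1 le2 DO leK).
case=> -[[[Sa Na] p] tot] q t1 [let1 tab -> -> ->]; do 2 apply: wp_bind_op.
apply/wp_bind/wp_rdiv; first by rewrite pnatr_eq0 muln_eq0 negb_or -!lt0n m0 m'0.
apply/wp_bind/wp_mono; first exact: wp_initial_state.
move=> _ t2 [let2 ->]; apply/wp_bind/wp_mono; first exact: wp_error.
move=> _ t3 [let3 ->]; apply/wp_bind/wp_mono; first exact: wp_selection_loop.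
move=> _ t4 [r [H [selr let4 ->]]].
apply/wp_bind/wp_mono; first exact: wp_gray_level.
move=> c1 t5 [let5 _]; apply/wp_bind/wp_mono; first exact: wp_gray_level.
move=> c2 t6 [let6 _]; apply: wp_op.
have let1' : (t1 <= M * (M * (K + 16) + 3) + 2 * (M + M) + 2)%N.
  apply: leq_trans let1 _; rewrite !leq_add // ?leq_mul // ?leq_add //.
  by rewrite leq_mul.
(* From N <= 2 M and M >= 1, a selection step costs at most 38 M + 28 <= 66 M. *)
have let4' : (t4 <= (kappa * M) * (66 * M))%N.
  by apply: leq_trans let4 _; rewrite leq_mul //; [exact: le_kappa selr | lia].
have leM : (M <= M * M)%N by rewrite leq_pmulr //; lia.
by rewrite -mulnn; nia.
Qed.

Lemma wp_nth_orientation (m m' k : nat) :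
  (0 < m)%N -> (0 < m')%N -> (k < m + m' - 1)%N ->
  wp (nth_orientation m' k) (fun O t => (t <= 3)%N /\ D_O m m' O).
Proof.
move=> m0 m'0 ltk; apply: wp_bind_op; case: ltnP => cmp.
  by apply: wp_op; split=> //; rewrite /D_O /= cmp.
do 2 apply: wp_bind_op; apply: wp_op; split=> //.
by rewrite /D_O /= subn1 eqxx andbT orbC; apply/orP; left; lia.
Qed.

Lemma wp_fast_patch (R : realType) (rho : raster R) (n : nat) (img : 'M[R]_n)
    (lo1 lo2 m m' M T : nat) :
  (0 < m <= M)%N -> (0 < m' <= M)%N ->
  (forall O, D_O m m' O ->
     wp (fast_orientation rho img lo1 lo2 m m' O) (fun _ t => (t <= T)%N)) ->
  wp (fast_patch rho img lo1 lo2 m m') (fun _ t => (t <= 2 * M * (T + 6) )%N).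
Proof.
move=> /andP[m0 lem] /andP[m'0 lem'] leT.
apply/wp_bind/wp_mono; first by apply: (@wp_nth_orientation m); lia.
move=> O t1 [let1 DO]; apply/wp_bind/wp_mono; first exact: leT.
move=> r0 t2 let2; do 2 apply: wp_bind_op; apply: wp_mono.
  apply: (@wp_for _ 1 (m + m' - 1) (T + 4) _ (fun _ _ => True)) => //; first lia.
  move=> k best /andP[_ ltk] _.
  apply/wp_bind/wp_mono; first exact: (@wp_nth_orientation m).
  move=> O' t3 [let3 DO']; apply/wp_bind/wp_mono; first exact: leT.
  by move=> r t4 let4; apply/wp_bind_op/wp_op; split=> //; lia.
move=> r t3 [let3 _].
(* At most 2 M - 2 rounds remain after the first orientation, which leaves 2 (T + 6) for that
   orientation and the overhead. *)
have : ((m + m' - 1 - 1) * (T + 4 + 2) + (T + 7) <= 2 * M * (T + 6))%N by nia.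
lia.
Qed.

(** * Levels of the quadtree and the whole image *)

(** [b] is the ceiling of j n / s, characterized without division. *)
Lemma dyadic_boundP (n s j : nat) (b := ((j * n + s - 1) %/ s)%N) :
  (0 < s)%N -> (j * n <= s * b < j * n + s)%N.
Proof.
move=> s0; have := divn_eq (j * n + s - 1) s; rewrite -/b.
by have := ltn_pmod (j * n + s - 1) s0; lia.
Qed.

Lemma wp_fast_level (R : realType) (rho : raster R) (n : nat) (img : 'M[R]_n)
    (s T : nat) (out : seq (nat * nat * nat * approx R)) :
  (0 < s <= n)%N ->
  (forall lo1 lo2 m m', (lo1 + m <= n)%N -> (lo2 + m' <= n)%N ->
     (0 < m)%N -> (s * m <= 2 * n)%N -> (0 < m')%N -> (s * m' <= 2 * n)%N ->
     wp (fast_patch rho img lo1 lo2 m m') (fun _ t => (t <= T)%N)) ->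
  wp (fast_level rho img s out) (fun _ t => (t <= s * (s * (T + 31) + 3) + 1)%N).
Proof.
move=> /andP[s0 lesn] leT.
(* Since s <= n, the ceilings at [j] and [j + 1] differ, and s (hi - lo) < n + s <= 2 n. *)
have bounds j : (j < s)%N ->
    let lo := ((j * n + s - 1) %/ s)%N in
    let hi := (((j + 1) * n + s - 1) %/ s)%N in
    [/\ (lo + (hi - lo) <= n)%N, (0 < hi - lo)%N & (s * (hi - lo) <= 2 * n)%N].
  move=> ltjs lo hi.
  have := dyadic_boundP n j s0; have := dyadic_boundP n (j + 1) s0.
  rewrite -/lo -/hi => /andP[ge_hi lt_hi] /andP[ge_lo lt_lo].
  by split; nia.
apply: wp_mono.
  apply: (@wp_for _ 0 s (s * (T + 31) + 1) _ (fun _ _ => True)) => //.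
  move=> j1 {}out /andP[_ ltj1] _; apply: wp_mono.
    apply: (@wp_for _ 0 s (T + 29) _ (fun _ _ => True)) => //.
    move=> j2 {}out /andP[_ ltj2] _.
    have [le1 gt1 small1] := bounds _ ltj1.
    have [le2 gt2 small2] := bounds _ ltj2.
    do 2 apply: wp_bind_op.
    (* Four bounds at 4 operations each, with 2 increments, 2 subtractions and 9 for [emit], make
       the 29. *)
    do 4 (apply: wp_bind; do 3 apply: wp_bind_op; apply: wp_idiv => //).
    do 2 apply: wp_bind_op; apply/wp_bind/wp_mono; first exact: leT.
    by move=> r t let_; apply: wp_op; split=> //; lia.
  by move=> r t [let_ _]; split=> //; lia.
by move=> r t [let_ _]; lia.
Qed.

(** The hypothesis says that level s takes time at most B / s, multiplied out to stay in the
    naturals. *)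
Lemma wp_fast_image (R : realType) (rho : raster R) (n B : nat) (img : 'M[R]_n) :
  (0 < n)%N ->
  (forall s out, (0 < s <= n)%N ->
     wp (fast_level rho img s out) (fun _ t => (s * t <= B)%N)) ->
  wp (fast_image rho img) (fun _ t => (t <= 2 * (B + 2 * n))%N).
Proof.
move=> n0 leB.
(* The time from s on is at most 2 (B + 2 n) / s, a geometric series. *)
suff from_s : forall f s out, (2 * n < s + f)%N -> (0 < s <= 2 * n)%N ->
    wp (loop (fun st : nat * seq (nat * nat * nat * approx R) =>
          let '(s, out) := st in
          b <- ile s n ;;
          if b then
            out' <- fast_level rho img s out ;;
            s' <- imul 2 s ;;
            ret ((s', out'), true)
          else ret ((s, out), false))%comp (s, out))
       (fun _ t => (s * t <= 2 * (B + 2 * n))%N).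
  apply: wp_mono; first by apply: (from_s (2 * n)%N); lia.
  by move=> r t /=; lia.
(* [f] is fuel: doubling s >= 1 raises s by at least 1. The last s tested may exceed n, but not 2
   n. *)
elim=> [|f IHf] s out bound /andP[s0 les]; first lia.
apply/wp_loop/wp_bind_op; case: leqP => cmp; last by apply: wp_op => /=; lia.
apply/wp_bind/wp_mono; first by apply: leB; lia.
move=> out' t let_; apply/wp_bind_op/wp_op => /=.
apply: wp_mono; first by apply: IHf; lia.
(* The level gives s t <= B, the rest s t' <= B + 2 n, and the test and the doubling 2 s <= 2 n. *)
by move=> r t' let' /=; nia.
Qed.

Theorem theorem2 (R : realType) (rho : raster R)
    (hkappa : exists kappa : R,
       forall (m m' : nat) (w : 'M[R]_(m, m')) (O : nat * nat) (r : nat),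
         (0 < m)%N -> (0 < m')%N -> D_O m m' O ->
         selections w (G0 rho w O) r -> r%:R <= kappa * (maxn m m')%:R) :
  exists C : R, forall (n : nat) (img : 'M[R]_n), (0 < n)%N ->
    runs_within (fast_image rho img) (C * n%:R ^+ 3).
Proof.
have [kappaR le_kappaR] := hkappa; have [K leK] := line_cost_O1 rho.
(* A natural bound replaces the real constant, with the absolute value as its sign is unknown; [A]
   is the factor of M^2 in the cost of an orientation. *)
pose kappa := Num.bound `|kappaR|; pose A := (K + 66 * kappa + 70)%N.
exists (2 * (16 * A + 200))%:R => n img n0.
have le_kappa m m' (w : 'M[R]_(m, m')) O r M : (0 < m <= M)%N -> (0 < m' <= M)%N ->
    D_O m m' O -> selections w (G0 rho w O) r -> (r <= kappa * M)%N.
  move=> /andP[m0 lem] /andP[m'0 lem'] DO /(le_kappaR _ _ _ _ _ m0 m'0 DO) ler.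
  rewrite -(ler_nat R) natrM; apply: le_trans ler _.
  apply: (@le_trans _ _ (kappa%:R * (maxn m m')%:R)).
    rewrite ler_wpM2r //; apply: le_trans (ler_norm _) _.
    by apply/ltW/archi_boundP.
  by rewrite ler_wpM2l // ler_nat geq_max lem lem'.
have level s out : (0 < s <= n)%N ->
    wp (fast_level rho img s out) (fun _ t => (s * t <= (16 * A + 140) * n ^ 3)%N).
  move=> lesn; have /andP[s0 les] := lesn.
  (* The largest side allowed by s m <= 2 n. *)
  pose M := ((2 * n) %/ s)%N.
  have leM : (s * M <= 2 * n)%N by rewrite mulnC leq_trunc_div.
  have M0 : (0 < M)%N by rewrite divn_gt0 //; lia.
  apply: wp_mono.
    apply: (@wp_fast_level _ _ _ _ _ (2 * M * (A * M ^ 2 + 6))) => //.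
    move=> lo1 lo2 m m' le1 le2 m0 sm m'0 sm'.
    have lem : (0 < m <= M)%N by rewrite m0 leq_divRL // mulnC.
    have lem' : (0 < m' <= M)%N by rewrite m'0 leq_divRL // mulnC.
    apply: wp_fast_patch => // O DO.
    apply: wp_fast_orientation => // [x y ltx lty|w r]; first exact: leK.
    exact: le_kappa.
  move=> out' t let_; apply: leq_trans (leq_mul (leqnn s) let_) _.
  (* The dominant term of s times the level cost is 2 A s^3 M^3 <= 16 A n^3; the remaining ones, in
     s^3 M, s^3, s^2 and s, are bounded by multiples of n^3 fitting in 140. *)
  have cube : (s ^ 3 * M ^ 3 <= 8 * n ^ 3)%N.
    by rewrite -(expnMn s M 3) -(expnMn 2 n 3) leq_exp2r.
  have s3 : (s ^ 3 <= n ^ 3)%N by rewrite leq_exp2r.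
  have sM : (s ^ 2 * (s * M) <= n ^ 2 * (2 * n))%N by rewrite leq_mul // leq_exp2r.
  have s2 : (s ^ 2 <= s ^ 3)%N by rewrite leq_pexp2l.
  have s1 : (s <= s ^ 3)%N by rewrite -{1}(expn1 s) leq_pexp2l.
  have cubeA := leq_mul (leqnn A) cube.
  rewrite !expnS !expn0 !muln1 in cube s3 sM s2 s1 cubeA *.
  by lia.
have [ex leT] := wp_fast_image n0 level; split=> // a t /leT let_.
rewrite -natrX -natrM ler_nat; apply: leq_trans let_ _.
have : (n <= n ^ 3)%N by rewrite -{1}(expn1 n) leq_pexp2l.
lia.
Qed.
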